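(* Let $n\geqslant 1$. Then $\mathrm{Isom}_e(K_0(\mathbb{P}_n))$ is a subgroup of index $2$ of the group $\mathrm{Isom}(K_0(\mathbb{P}_n))$.
   Context: $K_0(\mathbb{P}_n)$ is the Grothendieck group of coherent sheaves on the $n$-dimensional projective space $\mathbb{P}_n$ over a fixed ground field; it is a free $\mathbb{Z}$-module of rank $n+1$ with basis the classes of $\mathcal{O},\mathcal{O}(1),\dots,\mathcal{O}(n)$. The Euler form is the (nonsymmetric) nondegenerate bilinear form $\chi(E,F)=\sum_\nu(-1)^\nu\dim\mathrm{Ext}^\nu(E,F)$; it satisfies $\chi(\mathcal{O}(k),\mathcal{O}(m))=\binom{n+m-k}{n}$ for all $k,m\in\mathbb{Z}$, where $\binom{x}{n}=\frac{x(x-1)\cdots(x-n+1)}{n!}$. It is extended $\mathbb{R}$-bilinearly to $K_0(\mathbb{P}_n)\otimes\mathbb{R}$. $\mathrm{Isom}(K_0(\mathbb{P}_n))$ is the group of $\mathbb{Z}$-linear automorphisms of $K_0(\mathbb{P}_n)$ preserving $\chi$; $\mathrm{Isom}(K_0(\mathbb{P}_n)\otimes\mathbb{R})\subset GL(n+1,\mathbb{R})$ is the group of $\mathbb{R}$-linear automorphisms of $K_0(\mathbb{P}_n)\otimes\mathbb{R}$ preserving $\chi$, and $\mathrm{Isom}_e(K_0(\mathbb{P}_n)\otimes\mathbb{R})$ is its connected component of the identity. Regarding $\mathrm{Isom}(K_0(\mathbb{P}_n))$ as a subgroup of $\mathrm{Isom}(K_0(\mathbb{P}_n)\otimes\mathbb{R})$,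 one sets $\mathrm{Isom}_e(K_0(\mathbb{P}_n))=\mathrm{Isom}(K_0(\mathbb{P}_n))\cap \mathrm{Isom}_e(K_0(\mathbb{P}_n)\otimes\mathbb{R})$. *)

(* Defs.v *)
From HB Require Import structures.
From mathcomp Require Import all_boot all_order all_algebra.
From mathcomp Require Import all_classical all_reals all_analysis.

Set Implicit Arguments.
Unset Strict Implicit.
Unset Printing Implicit Defensive.

Import Order.TTheory GRing.Theory Num.Theory.
Import numFieldNormedType.Exports.

Local Open Scope classical_set_scope.
Local Open Scope ring_scope.

(* x (x - 1) ... (x - n + 1) / n! for x in Z; the division is exact. *)
Definition binz (x : int) (n : nat) : int :=
  ((\prod_(l < n) (x - l%:Z)) %/ (n`!)%:Z)%Z.

(* K_0(P_n) is identified with Z^(n+1) by means of the basis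
   [O], [O(1)], ..., [O(n)], and K_0(P_n) (x) R with R^(n+1); entry (k, m) of
   this matrix is chi(O(k), O(m)). *)
Definition euler_mx (n : nat) : 'M[int]_n.+1 :=
  \matrix_(k < n.+1, m < n.+1) binz (n%:Z + m%:Z - k%:Z) n.

(* A = int gives the Euler form of K_0(P_n), A = R its bilinear extension. *)
Definition euler (A : comUnitRingType) (n : nat) (x y : 'cV[A]_n.+1) : A :=
  (x^T *m map_mx intr (euler_mx n) *m y) ord0 ord0.

(* Automorphisms are given by their matrices, acting on column vectors. *)
Definition isom (A : comUnitRingType) (n : nat) : set 'M[A]_n.+1 :=
  [set f | f \in unitmx /\
    forall x y : 'cV[A]_n.+1, euler (f *m x) (f *m y) = euler x y].

Definition isom_e_real (R : realType) (n : nat) : set 'M[R]_n.+1 :=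
  connected_component (@isom R n) 1.

Definition isom_e (R : realType) (n : nat) : set 'M[int]_n.+1 :=
  @isom int n `&` [set f | @isom_e_real R n (map_mx intr f)].

(* Meant for G a group of units of the ring T. *)
Definition is_subgroup (T : unitRingType) (H G : set T) : Prop :=
  [/\ H `<=` G, H 1,
      forall f g, H f -> H g -> H (f * g) &
      forall f, H f -> H f^-1].

Definition left_cosets (T : unitRingType) (H G : set T) : set (set T) :=
  [set [set g * h | h in H] | g in G].

Definition has_index (T : unitRingType) (H G : set T) (k : nat) : Prop :=
  (left_cosets H G #= `I_k)%card.

Lemma euler_mxE (n : nat) (k m : 'I_n.+1) :
  euler_mx n k m = 'C(n + m - k, n)%:Z.
Proof.
rewrite mxE /binz.
have lek : (k <= n + m)%N by rewrite (leq_trans _ (leq_addr _ _)) // -ltnS.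
rewrite -PoszD subzn //; move: (n + m - k)%N => x.
have -> : \prod_(l < n) (x%:Z - l%:Z) = (x ^_ n)%:Z.
  elim: n {k m lek} => [|n IHn]; first by rewrite big_ord0 ffactn0.
  rewrite big_ord_recr /= IHn ffactnSr PoszM.
  have [le_nx|lt_xn] := leqP n x; first by rewrite subzn.
  by rewrite ffact_small // !mul0r.
by rewrite -bin_ffact PoszM mulzK // eqz_nat -lt0n fact_gt0.
Qed.

Lemma isom_is_group (A : comUnitRingType) (n : nat) :
  is_subgroup (@isom A n) [set f | f \is a GRing.unit].
Proof.
split=> [f [] //||f g [uf ef] [ug eg]|f [uf ef]].
- by split=> [|x y]; rewrite ?unitmx1 // !mul1mx.
- split=> [|x y]; first by rewrite unitmx_mul uf.
  by rewrite -!mulmxA ef eg.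
- split=> [|x y]; first by rewrite unitmx_inv.
  by rewrite -[LHS]ef !mulKVmx.
Qed.

(* Main.v *)
Require Import Defs.
From HB Require Import structures.
From mathcomp Require Import all_boot all_order all_algebra.
From mathcomp Require Import all_classical all_reals all_analysis.
From mathcomp Require Import ring.

(** Let [E] be the matrix of the Euler form, [E k m = h (m - k)] with [h] the
Hilbert polynomial of [O], and let [V] be the matrix with
[E^T V = (-1)^n E].  Serre duality [h (- x - n - 1) = (-1)^n h x] shows that,
identifying row vectors with polynomials of degree at most [n] through their
values at [0 .. n], [V] is the shift [p (X) |-> p (X + n + 1)], a unipotent
matrix with a single Jordan block.  Every isometry commutes with [V], hence
with its Cayley transform [C = (V - 1) (V + 1)^-1], which is nilpotent with a
single Jordan block and skew for the Euler form.  So the real isometries are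
the [p (C)] with [p (- X) p (X) = 1] modulo [X^(n+1)], and [p (0) = 1] or
[p (0) = -1].  The path [t |-> p (t C)] joins [p (C)] to [p (0)] inside the
group, and the sign [p (0)], read off on a common eigenvector, is continuous.
Hence the identity component is [p (0) = 1], and [-1] represents the other
coset. *)

Set Implicit Arguments.
Unset Strict Implicit.
Unset Printing Implicit Defensive.

Import Order.TTheory GRing.Theory Num.Theory.
Import numFieldNormedType.Exports.

Local Open Scope classical_set_scope.
Local Open Scope ring_scope.

(** * Nilpotent matrices with a cyclic vector, and their commutants *)

Section CyclicNilpotent.
Variables (F : fieldType) (n : nat) (A : 'M[F]_n.+1) (v : 'rV[F]_n.+1).
Hypotheses (An0 : A ^+ n.+1 = 0) (vAn : v *m A ^+ n != 0).

(** The row [v *m A ^+ n] is killed by [A], so only the constant term of [p] acts on it. *)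
Lemma cyclic_horner_mx (p : {poly F}) :
  v *m A ^+ n *m horner_mx A p = p`_0 *: (v *m A ^+ n).
Proof.
elim/poly_ind: p => [|p c _]; first by rewrite rmorph0 mulmx0 coef0 scale0r.
rewrite mulrC rmorphD rmorphM /= horner_mx_X horner_mx_C mulmxDr mul_mx_scalar.
rewrite [_ * p]mulrC coefD coefMX coefC /= add0r -[RHS]add0r; congr (_ + _).
by rewrite -mulmxA [A ^+ n *m _]mulrA -exprSr An0 mul0r mulmx0.
Qed.

(** If [g = h * 'X^d] with [d <= n], multiplying [v g(A) = 0] by [A ^+ (n - d)] leaves [h(0)] times
    the nonzero row [v *m A ^+ n]. Hence [h(0) = 0], and one more factor ['X] divides [g]. *)
Lemma dvdp_Xn_annihilator (g : {poly F}) :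
  v *m horner_mx A g = 0 -> 'X^(n.+1) %| g.
Proof.
move=> vg0; suff: forall d, (d <= n.+1)%N -> 'X^d %| g by apply.
elim=> [_|d IHd le_dn]; first by rewrite expr0 dvd1p.
have /dvdpP[h gE] := IHd (ltnW le_dn).
have h0 : h`_0 = 0.
  apply/eqP; move: vg0 => /(congr1 (fun u => u *m A ^+ (n - d))) /eqP.
  have XnE k : A ^+ k = horner_mx A 'X^k by rewrite rmorphXn /= horner_mx_X.
  rewrite mul0mx -mulmxA [A ^+ (n - d)]XnE.
  rewrite [_ *m horner_mx A _](esym (rmorphM (horner_mx A) _ _)).
  rewrite gE -mulrA -exprD subnKC // [h * _]mulrC rmorphM rmorphXn /= horner_mx_X.
  rewrite [v *m _]mulmxA.
  by rewrite cyclic_horner_mx scaler_eq0 (negPf vAn) orbF.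
rewrite gE exprS dvdp_mul2r ?expf_neq0 ?polyX_eq0 //.
by rewrite -['X]subr0 -polyC0 dvdp_XsubCl rootE horner_coef0 h0.
Qed.

(** The rows [v *m A ^+ i], [i <= n], form a basis, so [v f = v p(A)] for some [p]. As [f] and
    [p(A)] both commute with [A], they then agree on the whole basis. *)
Lemma commutant_cyclic_nilpotent (f : 'M[F]_n.+1) :
  comm_mx A f -> exists p, f = horner_mx A p.
Proof.
move=> cAf; pose B : 'M[F]_n.+1 := \matrix_(i < n.+1) (v *m A ^+ i).
have mulB u : u *m B = v *m horner_mx A (rVpoly u).
  rewrite mulmx_sum_row /rVpoly poly_def rmorph_sum mulmx_sumr.
  apply: eq_bigr => i _; rewrite rowK insubT //= => lt_i.
  rewrite horner_mxZ rmorphXn /= horner_mx_X -scalemxAr.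
  by congr (u _ _ *: _); apply: val_inj.
have Bfree : row_free B.
  apply: inj_row_free => u; rewrite mulB => /dvdp_Xn_annihilator dv.
  rewrite -[u]rVpolyK; have [->|nz] := eqVneq (rVpoly u) 0.
    by rewrite linear0.
  have := leq_trans (dvdp_leq nz dv) (size_poly _ _).
  by rewrite size_polyXn ltnn.
have Bunit : B \in unitmx by rewrite -row_free_unit.
exists (rVpoly (v *m f *m invmx B)).
set p := rVpoly _; have vp : v *m horner_mx A p = v *m f.
  by rewrite -mulB mulmxKV.
apply: (can_inj (mulKmx Bunit)); apply/row_matrixP => i; rewrite !row_mul !rowK.
have XiE : A ^+ i = horner_mx A 'X^i by rewrite rmorphXn /= horner_mx_X.
have cAif : comm_mx (A ^+ i) f by rewrite XiE; apply: comm_horner_mx.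
rewrite -mulmxA cAif mulmxA -vp -!mulmxA XiE; congr (_ *m _).
exact: comm_horner_mx2.
Qed.

End CyclicNilpotent.

(** The adjoint of [A] for [M] is [- A], so that of [p(A)] is [p(- A)]. This turns the isometry
    equation for [p(A)] into a congruence on [p]. *)
Lemma horner_mx_skew (R : comNzRingType) (n : nat) (A M : 'M[R]_n.+1) p :
  A^T *m M = - (M *m A) ->
  (horner_mx A p)^T *m M = M *m horner_mx A (p \Po - 'X).
Proof.
move=> skA; elim/poly_ind: p => [|p c IHp].
  by rewrite comp_poly0 !rmorph0 /= trmx0 mul0mx mulmx0.
rewrite comp_polyD comp_polyM comp_polyX comp_polyC [_ * - 'X]mulrC.
rewrite !(rmorphD, rmorphM, rmorphN) /= horner_mx_X !horner_mx_C linearD /=.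
rewrite trmx_mul tr_scalar_mx mulmxDl mulmxDr mul_scalar_mx mul_mx_scalar.
by congr (_ + _); rewrite -mulmxA IHp mulmxA skA mulNr mulmxN mulNmx mulmxA.
Qed.

(** * Shifts of polynomials, read on the values at [0 .. n] *)

Section Shift.
Variables (F : numFieldType) (n : nat) (c : F).
Implicit Types p q : {poly F}.

Definition poly_diff p := p \Po ('X + c%:P) - p.

(** Induction on the degree by a discrete product rule for [p1 * 'X]. For [k = 0], where [k.-1] is a
    default value, [p] is constant and both sides vanish. *)
Lemma poly_diff_lead p k : (size p <= k.+1)%N ->
  (size (poly_diff p) <= k)%N /\ (poly_diff p)`_k.-1 = c * p`_k *+ k.
Proof.
elim: k p => [|k IHk] p sp.
  rewrite /poly_diff (size1_polyC sp) comp_polyC subrr.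
  by rewrite size_poly0 coef0 mulr0n.
have [p1 [a pE]] : exists p1 a, p = p1 * 'X + a%:P.
  elim/poly_ind: p {sp} => [|p1 a _]; last by exists p1, a.
  by exists 0, 0; rewrite mul0r add0r.
have sp1 : (size p1 <= k.+1)%N.
  apply/leq_sizeP => j lj; move/leq_sizeP/(_ j.+1 lj): sp.
  by rewrite pE coefD coefMX coefC /= addr0.
have [sd d1] := IHk _ sp1.
have -> : poly_diff p = poly_diff p1 * 'X + c *: (poly_diff p1 + p1).
  rewrite /poly_diff pE comp_polyD comp_polyM comp_polyX comp_polyC.
  by rewrite -mul_polyC; ring.
split.
  apply/leq_sizeP => j lj; rewrite coefD coefMX coefZ [(_ + p1)`_ _]coefD.
  rewrite !(leq_sizeP _ _ sd) ?(leq_sizeP _ _ sp1) ?(ltnW lj) //.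
  - by rewrite if_same addr0 mulr0 addr0.
  - by rewrite -ltnS (ltn_predK lj).
have pk : p`_k.+1 = p1`_k by rewrite pE coefD coefMX coefC /= addr0.
rewrite pk coefD coefMX coefZ [(_ + p1)`_ _]coefD /=.
rewrite (leq_sizeP _ _ sd k) // add0r.
by case: k d1 {IHk sp sp1 sd pk} => [|k] d1; rewrite ?add0r //= d1 -mulrSr.
Qed.

Definition eval_row p : 'rV[F]_n.+1 := \row_(m < n.+1) p.[m%:R].

Lemma eval_row_inj p q : (size p <= n.+1)%N -> (size q <= n.+1)%N ->
  eval_row p = eval_row q -> p = q.
Proof.
move=> sp sq e; apply/eqP; rewrite -subr_eq0; apply/eqP.
apply: (@roots_geq_poly_eq0 _ _ [seq (i : nat)%:R | i <- iota 0 n.+1]).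
- apply/allP => x /mapP[i]; rewrite mem_iota => /andP[_ lt_i] ->.
  have /rowP/(_ (Ordinal lt_i)) := e; rewrite !mxE /= => ei.
  by rewrite rootE hornerD hornerN ei subrr.
- by rewrite map_inj_uniq ?iota_uniq // => i j /eqP; rewrite eqr_nat => /eqP.
- rewrite size_map size_iota (leq_trans (size_polyD _ _)) //.
  by rewrite size_polyN geq_max sp.
Qed.

Lemma eval_row_sum (a : 'rV[F]_n.+1) (w : 'I_n.+1 -> {poly F}) :
  a *m \matrix_(k < n.+1) eval_row (w k) = eval_row (\sum_k a 0 k *: w k).
Proof.
rewrite mulmx_sum_row; apply/rowP => m; rewrite summxE mxE horner_sum.
by apply: eq_bigr => k _; rewrite rowK !mxE hornerZ.
Qed.

Hypothesis c_neq0 : c != 0.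
Variables (w : 'I_n.+1 -> {poly F}) (V : 'M[F]_n.+1).
Hypothesis size_w : forall k, (size (w k) <= n.+1)%N.
Let W := \matrix_(k < n.+1) eval_row (w k).
Hypothesis W_unit : W \in unitmx.
Hypothesis WV : W *m V = \matrix_(k < n.+1) eval_row (w k \Po ('X + c%:P)).

Let size_sumw (a : 'rV[F]_n.+1) : (size (\sum_k a 0 k *: w k)%R <= n.+1)%N.
Proof.
apply: (leq_trans (size_sum _ _ _)); apply/bigmax_leqP => k _.
exact: (leq_trans (size_scale_leq _ _)).
Qed.

Lemma eval_row_surj u : exists2 p : {poly F}, (size p <= n.+1)%N & u = eval_row p.
Proof.
exists (\sum_k (u *m invmx W) 0 k *: w k) => //.
by rewrite -eval_row_sum mulmxKV.
Qed.

(** [WV] describes [V] on the rows of [W] only; as [W] is invertible, every such [p] is a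
    combination of the [w k], and linearity extends the shift to it. *)
Lemma eval_row_shift p : (size p <= n.+1)%N ->
  eval_row p *m V = eval_row (p \Po ('X + c%:P)).
Proof.
move=> sp; set a := eval_row p *m invmx W.
have pE : p = \sum_k a 0 k *: w k.
  by apply: eval_row_inj => //; rewrite -eval_row_sum mulmxKV.
rewrite [in LHS]pE -eval_row_sum -mulmxA WV eval_row_sum pE.
congr eval_row; rewrite raddf_sum /=; apply: eq_bigr => k _.
by rewrite comp_polyZ.
Qed.

(** On rows of values [V - 1] is the difference operator, and [j] differences reduce degree [j] to a
    constant. *)
Lemma eval_row_diffX p j : (j <= n)%N -> (size p <= j.+1)%N ->
  eval_row p *m (V - 1) ^+ j = eval_row (c ^+ j * p`_j *+ j`!)%:P.
Proof.
elim: j p => [|j IHj] p le_jn sp.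
  by rewrite expr0 mulmx1 mul1r mulr1n -size1_polyC.
have [sd dj] := poly_diff_lead sp.
rewrite exprS mulmxA mulmxBr mulmx1 eval_row_shift; last exact: leq_trans sp _.
have -> : eval_row (p \Po ('X + c%:P)) - eval_row p = eval_row (poly_diff p).
  by apply/rowP => m; rewrite !mxE hornerD hornerN.
rewrite (IHj _ (ltnW le_jn) sd) [(poly_diff p)`_j]dj factS.
by rewrite exprSr mulrnAr mulrA -mulrnA.
Qed.

Lemma shift_unipotent : (V - 1) ^+ n.+1 = 0.
Proof.
apply/row_matrixP => i; rewrite row0 rowE.
have [p sp ->] := eval_row_surj (delta_mx 0 i).
rewrite exprSr mulmxA eval_row_diffX // mulmxBr mulmx1 eval_row_shift.
  by rewrite comp_polyC subrr.
exact: leq_trans (size_polyC_leq1 _) _.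
Qed.

Lemma shift_cyclic : exists v : 'rV[F]_n.+1, v *m (V - 1) ^+ n != 0.
Proof.
exists (eval_row 'X^n); rewrite eval_row_diffX ?size_polyXn //.
apply/eqP => /rowP/(_ 0); rewrite !mxE hornerC coefXn eqxx mulr1 => /eqP.
by rewrite mulrn_eq0 expf_eq0 (negPf c_neq0) andbF orbF -leqn0 leqNgt fact_gt0.
Qed.

End Shift.

(** * The Cayley transform of a unipotent matrix *)

Section Cayley.
Variables (F : numFieldType) (n : nat) (V : 'M[F]_n.+1).
Hypothesis V_unip : (V - 1) ^+ n.+1 = 0.

(** As [1 - V] is nilpotent, [2 ^ n.+1] is the difference of the powers [n.+1] of [2] and [1 - V],
    hence a multiple of [2 - (1 - V) = V + 1]. *)
Lemma unipotentD1_unit : V + 1 \in unitmx.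
Proof.
have c12 : GRing.comm (2%:R : 'M[F]_n.+1) (1 - V).
  exact/commr_sym/commr_nat.
have := subrXX_comm n.+1 c12.
have -> : (1 - V) ^+ n.+1 = 0 by rewrite -opprB exprNn V_unip mulr0.
have -> : 2%:R - (1 - V) = V + 1 by rewrite opprB addrC mulr2n addrA subrK.
rewrite subr0 -natrX.
move=> /(congr1 (fun A => A \in unitmx)); rewrite unitmx_mul.
have -> : (2 ^ n.+1)%:R \in @unitmx F n.+1.
  rewrite -scaler_nat unitmxZ ?unitmx1 //.
  by rewrite unitfE pnatr_eq0 -lt0n expn_gt0.
by move/esym/andP => [].
Qed.

Definition cayley := (V - 1) * (V + 1)^-1.

Lemma comm_cayley (f : 'M[F]_n.+1) : GRing.comm V f -> GRing.comm cayley f.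
Proof.
move=> cVf; apply/commr_sym/commrM.
  by apply: commrB; [apply: commr_sym | apply: commr1].
by apply: commrV; apply: commrD; [apply: commr_sym | apply: commr1].
Qed.

Let cVV : GRing.comm (V - 1) (V + 1)^-1.
Proof.
apply: commrV; apply: commrD; last exact: commr1.
by apply/commr_sym/commrB => //; apply: commr1.
Qed.

Lemma cayleyX k : cayley ^+ k = (V - 1) ^+ k * (V + 1) ^- k.
Proof. by rewrite exprMn_comm // exprVn. Qed.

(** After multiplication by [(V + 1)^T] on the left and [V + 1] on the right, both sides expand to
    [V^T M - M V]. *)
Lemma cayley_skew (M : 'M[F]_n.+1) :
  V^T *m M *m V = M -> cayley^T *m M = - (M *m cayley).
Proof.
move=> VMV; have uV := unipotentD1_unit.
have uVT : (V + 1)^T \in unitmx by rewrite unitmx_tr.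
have CV : cayley *m (V + 1) = V - 1 by exact: mulrVK.
apply: (can_inj (mulKmx uVT)); apply: (can_inj (mulmxK uV)).
rewrite mulmxA -trmx_mul CV -[RHS]mulmxA mulNmx -(mulmxA M) CV.
rewrite linearB [(V + 1)^T]linearD /= trmx1 mulmxN !(mulmxBl, mulmxDl, mulmxBr, mulmxDr).
rewrite !mul1mx !mulmx1 !mulmxA VMV.
by rewrite addrC addrA subrK opprD !opprB addrA subrK.
Qed.

End Cayley.

(** * The Euler matrix, Serre duality and the shift by [n + 1] *)

Section EulerMatrix.
Variables (F : numFieldType) (n : nat).
Local Notation E := (map_mx intr (euler_mx n) : 'M[F]_n.+1).
Local Notation eps := ((-1) ^+ n : F).

(** This is the binomial coefficient of [X + n] over [n], whose value at an integer [x] is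
    [chi(O, O(x))]. *)
Definition hilbert_poly : {poly F} :=
  n`!%:R^-1 *: \prod_(l < n) ('X - (- l.+1%:R)%:P).

Lemma size_hilbert_poly : (size hilbert_poly <= n.+1)%N.
Proof.
apply: leq_trans (size_scale_leq _ _) _.
by rewrite -big_enum size_prod_XsubC size_enum_ord.
Qed.

Lemma hilbert_polyE x :
  hilbert_poly.[x] = n`!%:R^-1 * \prod_(l < n) (x + l.+1%:R).
Proof.
rewrite hornerZ horner_prod; congr (_ * _); apply: eq_bigr => l _.
by rewrite hornerXsubC opprK.
Qed.

Lemma hilbert_poly_rev x :
  hilbert_poly.[x] = n`!%:R^-1 * \prod_(l < n) (x + n%:R - l%:R).
Proof.
rewrite hilbert_polyE (reindex_inj rev_ord_inj); congr (_ * _).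
by apply: eq_bigr => l _; rewrite /= subnSK // natrB ?addrA // ltnW.
Qed.

(** Each factor at [- x - n - 1] is the opposite of a factor at [x], the product being taken in
    reverse order. *)
Lemma hilbert_poly_serre x :
  hilbert_poly.[- x - n.+1%:R] = eps * hilbert_poly.[x].
Proof.
rewrite hilbert_polyE hilbert_poly_rev mulrCA; congr (_ * _).
rewrite -[in (-1) ^+ _](card_ord n) -prodr_const -big_split /=.
by apply: eq_bigr => l _; rewrite -![_.+1%:R]natr1; ring.
Qed.

Lemma natr_ffact (a k : nat) : (a ^_ k)%:R = \prod_(l < k) (a%:R - l%:R) :> F.
Proof.
elim: k => [|k IHk]; first by rewrite big_ord0 ffactn0.
rewrite big_ord_recr /= -IHk ffactnSr natrM.
have [le_ka|lt_ak] := leqP k a; first by rewrite natrB.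
by rewrite ffact_small // !mul0r.
Qed.

Lemma euler_mx_hilbert k m : E k m = hilbert_poly.[m%:R - k%:R].
Proof.
rewrite mxE euler_mxE hilbert_poly_rev.
have lek : (k <= n + m)%N by rewrite (leq_trans _ (leq_addr _ _)) // -ltnS.
have -> : \prod_(l < n) (m%:R - k%:R + n%:R - l%:R) =
    ((n + m - k) ^_ n)%:R :> F.
  rewrite natr_ffact; apply: eq_bigr => l _; congr (_ - _).
  by rewrite natrB // natrD addrAC [n%:R + _]addrC.
by rewrite -bin_ffact natrM mulrC mulfK // pnatr_eq0 -lt0n fact_gt0.
Qed.

(** The matrix is upper triangular with diagonal 1, since the binomial coefficient vanishes for
    [m < k]; the transpose makes it lower triangular, as [det_trig] expects. *)
Lemma euler_mx_unit : E \in unitmx.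
Proof.
rewrite -unitmx_tr unitmxE det_trig; last first.
  apply/is_trig_mxP => i j lt_ij; rewrite 2!mxE euler_mxE bin_small //.
  rewrite -(ltn_add2r j) subnK ?ltn_add2l //.
  by rewrite (leq_trans _ (leq_addr _ _)) // -ltnS.
by rewrite big1 ?unitr1 // => i _; rewrite 2!mxE euler_mxE addnK binn.
Qed.

(** By Serre duality this is the action of the twist by [O(n + 1)] on classes. *)
Definition serre_mx : 'M[F]_n.+1 := eps *: (invmx E^T *m E).

Lemma serre_mxE : E^T *m serre_mx = eps *: E.
Proof. by rewrite -scalemxAr mulKVmx // unitmx_tr euler_mx_unit. Qed.

Let eps2 : eps * eps = 1.
Proof. by rewrite -exprD -signr_odd oddD addbb. Qed.

Lemma serre_mx_isometry : serre_mx^T *m E *m serre_mx = E.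
Proof.
have -> : serre_mx^T *m E = eps *: E^T.
  by rewrite -[E in LHS]trmxK -trmx_mul serre_mxE linearZ.
by rewrite -scalemxAl serre_mxE scalerA eps2 scale1r.
Qed.

(** Chosen so that, by Serre duality, the values of [w k] at [0 .. n] are row [k] of [eps *: E^T];
    applying [serre_mx] gives row [k] of [E], the values of [w k] shifted by [n + 1]. *)
Let w (k : 'I_n.+1) := hilbert_poly \Po ('X - (k%:R + n.+1%:R)%:P).

Let size_w k : (size (w k) <= n.+1)%N.
Proof. by rewrite /w size_comp_poly2 ?size_XsubC ?size_hilbert_poly. Qed.

Let WE : \matrix_(k < n.+1) eval_row n (w k) = eps *: E^T.
Proof.
apply/matrixP => k m; rewrite [RHS]mxE [E^T _ _]mxE euler_mx_hilbert.
rewrite -hilbert_poly_serre !mxE horner_comp hornerXsubC; congr _.[_]; ring.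
Qed.

Let W_unit : \matrix_(k < n.+1) eval_row n (w k) \in unitmx.
Proof.
by rewrite WE unitmxZ ?unitmx_tr ?euler_mx_unit // unitrX // unitrN unitr1.
Qed.

Let WV : \matrix_(k < n.+1) eval_row n (w k) *m serre_mx =
  \matrix_(k < n.+1) eval_row n (w k \Po ('X + n.+1%:R%:P)).
Proof.
rewrite WE -scalemxAl serre_mxE scalerA eps2 scale1r.
apply/matrixP => k m; rewrite euler_mx_hilbert !mxE.
rewrite !horner_comp hornerXsubC hornerD hornerX hornerC; congr _.[_]; ring.
Qed.

Lemma serre_mx_unipotent : (serre_mx - 1) ^+ n.+1 = 0.
Proof. exact: shift_unipotent size_w W_unit WV. Qed.

Lemma serre_mx_cyclic : exists v : 'rV[F]_n.+1, v *m (serre_mx - 1) ^+ n != 0.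
Proof. by apply: shift_cyclic size_w W_unit WV; rewrite pnatr_eq0. Qed.

(** An isometry preserves [E] and [E^T], from which [serre_mx] is built: both products become
    [eps *: E] once multiplied on the left by the invertible [f^T *m E^T]. *)
Lemma isometry_comm_serre (f : 'M[F]_n.+1) :
  f \in unitmx -> f^T *m E *m f = E -> comm_mx serre_mx f.
Proof.
move=> uf fEf; have fETf : f^T *m E^T *m f = E^T.
  by rewrite -[in RHS]fEf !trmx_mul trmxK mulmxA.
have ufT : f^T \in unitmx by rewrite unitmx_tr.
have uE : E^T \in unitmx by rewrite unitmx_tr euler_mx_unit.
apply: (can_inj (mulKmx uE)); apply: (can_inj (mulKmx ufT)).
transitivity (eps *: E).
  rewrite (mulmxA E^T) serre_mxE -scalemxAl -scalemxAr.
  by rewrite (mulmxA f^T E f) fEf.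
by rewrite (mulmxA E^T) (mulmxA f^T) (mulmxA f^T) fETf serre_mxE.
Qed.

(** The powers of the Cayley transform are those of [serre_mx - 1] times a unit, so nilpotency and
    the cyclic row carry over. *)
Lemma skew_cyclic_commutant_exists : exists (C : 'M[F]_n.+1) (v : 'rV[F]_n.+1),
  [/\ C ^+ n.+1 = 0, v *m C ^+ n != 0, C^T *m E = - (E *m C) &
      forall f : 'M[F]_n.+1,
        f \in unitmx -> f^T *m E *m f = E -> comm_mx C f].
Proof.
have Vu := serre_mx_unipotent; have [v vV] := serre_mx_cyclic.
exists (cayley serre_mx), v; split.
- by rewrite cayleyX Vu mul0r.
- rewrite cayleyX mulmxA; apply: contra vV => /eqP v0.
  have uX : (serre_mx + 1) ^- n \in unitmx.
    by rewrite unitmx_inv -/(_ \is a GRing.unit) unitrX // unipotentD1_unit.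
  by apply/eqP/(can_inj (mulmxK uX)); rewrite mul0mx.
- exact: cayley_skew serre_mx_isometry.
- by move=> f uf fEf; apply: comm_cayley; apply: isometry_comm_serre.
Qed.

End EulerMatrix.

(** * Isometries in matrix form, and continuity of matrix polynomials *)

Lemma isomP (A : comUnitRingType) (n : nat) (f : 'M[A]_n.+1) :
  isom f <-> f \in unitmx /\
    f^T *m map_mx intr (euler_mx n) *m f = map_mx intr (euler_mx n).
Proof.
split=> -[uf ef]; split=> //; last first.
  by move=> x y; rewrite /euler trmx_mul -[in RHS]ef !mulmxA.
apply/matrixP => i j.
have entry (X : 'M[A]_n.+1) :
    X i j = ((delta_mx i 0)^T *m X *m delta_mx j 0 : 'M[A]_1) 0 0.
  by rewrite trmx_delta -rowE -colE !mxE.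
rewrite !entry; have := ef (delta_mx i 0) (delta_mx j 0).
by rewrite /euler trmx_mul !mulmxA.
Qed.

Lemma isom_map_intr (F : numFieldType) (n : nat) (f : 'M[int]_n.+1) :
  isom f -> isom (map_mx intr f : 'M[F]_n.+1).
Proof.
move=> /isomP[_ fEf]; apply/isomP.
have e : (map_mx intr f)^T *m map_mx intr (euler_mx n) *m map_mx intr f =
    map_mx intr (euler_mx n) :> 'M[F]_n.+1.
  rewrite map_trmx -!map_mxM; congr (map_mx intr _).
  (* Over [int] the map [intr] is the identity. *)
  have <- : map_mx intr (euler_mx n) = euler_mx n :> 'M[int]_n.+1.
    by apply/matrixP => i j; rewrite mxE intz.
  exact: fEf.
split=> //; have := euler_mx_unit F n.
by rewrite -e unitmx_mul => /andP[].
Qed.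

Lemma continuous_sumZ (K : numFieldType) (T : topologicalType)
    (U : normedModType K) (m : nat) (a : 'I_m -> T -> K) (u : 'I_m -> U) :
  (forall i, continuous (a i)) ->
  continuous (fun t => \sum_(i < m) a i t *: u i).
Proof.
elim: m a u => [|m IHm] a u ca.
  by under eq_fun do rewrite big_ord0; exact: cst_continuous.
under eq_fun do rewrite big_ord_recr /=.
move=> t; apply: cvgD; first by apply: IHm => i; exact: ca.
by apply: cvgZ; [exact: ca | exact: cvg_cst].
Qed.

Lemma continuous_horner_mx_line (R : realType) (n : nat) (C : 'M[R]_n.+1) p :
  continuous (fun t : R => horner_mx (t *: C) p).
Proof.
have -> : (fun t : R => horner_mx (t *: C) p) =
    (fun t => \sum_(i < size p) (p`_i *: 'X^i).[t] *: C ^+ i).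
  apply/funext => t; rewrite -[in LHS](coefK p) poly_def rmorph_sum /=.
  apply: eq_bigr => i _; rewrite horner_mxZ rmorphXn /= horner_mx_X.
  by rewrite hornerZ hornerXn exprZn scalerA.
by apply: continuous_sumZ => i; exact: continuous_horner.
Qed.

Lemma horner_mx0 (R : comNzRingType) (n : nat) (p : {poly R}) :
  horner_mx (0 : 'M[R]_n.+1) p = (p`_0)%:M.
Proof.
elim/poly_ind: p => [|p c _]; first by rewrite rmorph0 coef0 raddf0.
rewrite rmorphD rmorphM /= horner_mx_X horner_mx_C mulr0 add0r.
by rewrite coefD coefMX coefC add0r.
Qed.

(** * The real isometry group and its identity component *)

Section RealIsometries.
Variables (R : realType) (n : nat).
Local Notation E := (map_mx intr (euler_mx n) : 'M[R]_n.+1).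
Variables (C : 'M[R]_n.+1) (v : 'rV[R]_n.+1).
Hypotheses (Cn0 : C ^+ n.+1 = 0) (vCn : v *m C ^+ n != 0).
Hypothesis C_skew : C^T *m E = - (E *m C).
Hypothesis C_comm : forall f : 'M[R]_n.+1,
  f \in unitmx -> f^T *m E *m f = E -> comm_mx C f.

Let w := v *m C ^+ n.

(** Commuting with [C] gives [p]; skewness gives [p(- C) p(C) = 1], and the cyclic row turns this
    into a divisibility. *)
Lemma isom_horner_mx (f : 'M[R]_n.+1) : isom f ->
  exists2 p : {poly R}, f = horner_mx C p & 'X^(n.+1) %| (p \Po - 'X) * p - 1.
Proof.
move=> /isomP[uf fEf].
have [p fE] := commutant_cyclic_nilpotent Cn0 vCn (C_comm uf fEf).
exists p => //; apply: (dvdp_Xn_annihilator Cn0 vCn).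
rewrite rmorphB rmorphM rmorph1 /= mulmxBr mulmx1; apply/eqP.
rewrite subr_eq0; apply/eqP; rewrite -[RHS]mulmx1; congr (_ *m _).
apply: (can_inj (mulKmx (euler_mx_unit R n))).
by rewrite mulmx1 [_ * _]/(_ *m _) mulmxA -(horner_mx_skew p C_skew) -fE.
Qed.

(** Scaling keeps [C] skew and nilpotent, so one congruence on [p] serves for every [t] and yields a
    path of isometries. *)
Lemma horner_mx_isom p t :
  'X^(n.+1) %| (p \Po - 'X) * p - 1 -> isom (horner_mx (t *: C) p).
Proof.
move=> /dvdpP[h hE]; have skt : (t *: C)^T *m E = - (E *m (t *: C)).
  by rewrite linearZ /= -scalemxAl C_skew -scalemxAr scalerN.
have pp : horner_mx (t *: C) (p \Po - 'X) *m horner_mx (t *: C) p = 1.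
  apply/eqP; rewrite -subr_eq0 -[X in _ - X](rmorph1 (horner_mx (t *: C))).
  rewrite [_ *m _](esym (rmorphM (horner_mx (t *: C)) _ _)) -rmorphB hE.
  by rewrite rmorphM rmorphXn /= horner_mx_X exprZn Cn0 scaler0 mulr0.
apply/isomP; split; first by case/mulmx1_unit: pp.
by rewrite (horner_mx_skew p skt) -mulmxA pp mulmx1.
Qed.

Lemma dvdp_skew_coef0 (p : {poly R}) :
  'X^(n.+1) %| (p \Po - 'X) * p - 1 -> p`_0 = 1 \/ p`_0 = -1.
Proof.
move=> /dvdpP[h /(congr1 (horner^~ 0))].
rewrite hornerM hornerXn expr0n mulr0 hornerD hornerN hornerM horner_comp.
rewrite hornerN hornerX oppr0 hornerC -expr2 horner_coef0 => /eqP.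
by rewrite subr_eq0 sqrf_eq1 => /orP[]/eqP; [left|right].
Qed.

Lemma isom_eigen f : isom f -> w *m f = w \/ w *m f = - w.
Proof.
move=> /isom_horner_mx[p -> /dvdp_skew_coef0 p0]; rewrite cyclic_horner_mx //.
by case: p0 => ->; [left; rewrite scale1r | right; rewrite scaleN1r].
Qed.

Lemma isom_e_realP f : isom_e_real f <-> isom f /\ w *m f = w.
Proof.
split=> [[A [A1 sA cA] Af]|[fi wf]].
  have fi := sA _ Af; split=> //; have [//|wfN] := isom_eigen fi.
  have /matrix0Pn[i [j]] := vCn; rewrite (ord1 i) -/w => wj.
  (* On isometries [phi] takes only the nonzero values [w 0 j] and [- w 0 j]; if both occurred on
     the connected set [A], so would 0. *)
  pose phi (g : 'M[R]_n.+1) : R := (w *m g) 0 j.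
  have phi_cont : continuous phi.
    have -> : phi = fun g => \sum_k g k j *: (w 0 k : R^o).
      apply/funext => g; rewrite /phi mxE.
      by apply: eq_bigr => k _; rewrite mulrC.
    by apply: continuous_sumZ => k; exact: coord_continuous.
  have /connected_intervalP phiA : connected [set phi x | x in A].
    apply: connected_continuous_connected => //.
    exact: continuous_subspaceT.
  have phi1 : [set phi x | x in A] (w 0 j).
    by exists 1; rewrite // /phi mulmx1.
  have phif : [set phi x | x in A] (- w 0 j).
    by exists f; rewrite // /phi wfN mxE.
  have [g Ag phig] : [set phi x | x in A] 0.
    have [w0|w0] := leP 0 (w 0 j).
      by apply: phiA phif phi1 _ _; rewrite oppr_le0 w0.
    by apply: phiA phi1 phif _ _; rewrite oppr_ge0 ltW.
  have /eqP := phig; rewrite /phi.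
  case: (isom_eigen (sA _ Ag)) => ->; last rewrite [(- w) 0 j]mxE oppr_eq0.
    by rewrite (negPf wj).
  by rewrite (negPf wj).
have [p fE dv] := isom_horner_mx fi.
have p0 : p`_0 = 1.
  move: wf; rewrite fE cyclic_horner_mx // -[X in _ = X]scale1r => /eqP.
  by rewrite -subr_eq0 -scalerBl scaler_eq0 (negPf vCn) orbF subr_eq0 => /eqP.
(* The line [t |-> p(t C)] is a connected set of isometries through [1] at [t = 0] and [f] at
   [t = 1]. *)
exists [set horner_mx (t *: C) p | t in [set: R]]; last first.
  by exists 1; rewrite // scale1r.
split.
- by exists 0; rewrite // scale0r horner_mx0 p0.
- by move=> _ [t _ <-]; exact: horner_mx_isom.
- apply: connected_continuous_connected; first exact/connected_intervalP.
  apply: continuous_subspaceT; exact: continuous_horner_mx_line.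
Qed.

End RealIsometries.

(** * Index two, and the passage to integral isometries *)

Lemma subgroup_index2 (T : unitRingType) (H G : set T) (s : T) :
  is_subgroup G [set f | f \is a GRing.unit] -> is_subgroup H G ->
  G s -> ~ H s -> (forall g, G g -> ~ H g -> H (s^-1 * g)) ->
  has_index H G 2.
Proof.
move=> [Gu _ GM GV] [HG H1 HM HV] Gs nHs Hs.
have us := Gu _ Gs.
pose sH := [set s * h | h in H].
have cosets : left_cosets H G = [set H; sH].
  apply/seteqP; split=> [_ [g Gg <-]|S].
    have [Hg|nHg] := pselect (H g).
      left; apply/seteqP; split=> [_ [h Hh <-]|h Hh]; first exact: HM.
      by exists (g^-1 * h); [apply: HM => //; exact: HV | rewrite mulVKr // Gu].
    have Hsg := Hs _ Gg nHg.
    right; apply/seteqP; split=> [_ [h Hh <-]|_ [h Hh <-]].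
      exists (s^-1 * g * h); first exact: HM.
      by rewrite -mulrA mulVKr.
    exists ((s^-1 * g)^-1 * h); first by apply: HM => //; exact: HV.
    by rewrite invrM ?unitrV ?Gu // invrK mulrA mulVKr // Gu.
  case=> ->; last by exists s.
  exists 1; first exact: HG.
  apply/seteqP; split=> [_ [h Hh <-]|h Hh]; first by rewrite mul1r.
  by exists h; rewrite ?mul1r.
have nsH1 : ~ sH 1.
  move=> [h Hh sh1]; apply: nHs.
  suff -> : s = h^-1 by exact: HV.
  by rewrite -[s](mulrK (Gu _ (HG _ Hh))) sh1 mul1r.
rewrite /has_index cosets; apply/card_set_bijP.
(* Only the trivial coset contains 1, which numbers the two cosets. *)
exists (fun S => if `[< S 1 >] then 0%N else 1%N); split.
- by move=> S _ /=; case: ifP.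
- have H1T : `[< H 1 >] by apply/asboolP.
  have sH1F : `[< sH 1 >] = false by apply/asboolP.
  by move=> S S' /set_mem[]-> /set_mem[]->; rewrite ?H1T ?sH1F.
- move=> [|[|//]] _; [exists H; first by left | exists sH; first by right].
    by rewrite asboolT.
  by rewrite asboolF.
Qed.

Theorem lemma4 (R : realType) (n : nat) (hn : (1 <= n)%N) :
  is_subgroup (@isom_e R n) (@isom int n) /\
  has_index (@isom_e R n) (@isom int n) 2.
Proof.
have [C [v [Cn0 vCn C_skew C_comm]]] := skew_cyclic_commutant_exists R n.
pose w := v *m C ^+ n.
pose rho (f : 'M[int]_n.+1) : 'M[R]_n.+1 := map_mx intr f.
have rhoM f g : rho (f * g) = rho f *m rho g by exact: map_mxM.
have rho1 : rho 1 = 1 by exact: map_mx1.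
(* Membership reduces to fixing [w], which makes the subgroup laws and the coset of [- 1] linear
   algebra on one row. *)
have HP f : isom_e R f <-> isom f /\ w *m rho f = w.
  split=> [[fi /(isom_e_realP Cn0 vCn C_skew C_comm)[_ ?]] //|[fi wf]].
  split=> //; apply/(isom_e_realP Cn0 vCn C_skew C_comm); split=> //.
  exact: isom_map_intr.
have Gsub := isom_is_group int n; have [Gu G1 GM GV] := Gsub.
have wV f : isom f -> w *m rho f = w -> w *m rho f^-1 = w.
  by move=> fi wf; rewrite -[in LHS]wf -mulmxA -rhoM mulrV ?Gu // rho1 mulmx1.
have GN1 : isom (- 1 : 'M[int]_n.+1).
  apply/isomP; split; first by rewrite -scaleN1r unitmxZ ?unitmx1.
  by rewrite [(- 1)^T]linearN /= trmx1 mulmxN mulNmx mul1mx mulmx1 opprK.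
have rhoN1 : w *m rho (- 1) = - w.
  by rewrite /rho map_mxN [map_mx _ _]rho1 mulmxN mulmx1.
have Hsub : is_subgroup (@isom_e R n) (@isom int n).
  split=> [f [] //||f g /HP[fi wf] /HP[gi wg]|f /HP[fi wf]]; apply/HP.
  - by split=> //; rewrite rho1 mulmx1.
  - by split; [exact: GM | rewrite rhoM mulmxA wf].
  - by split; [exact: GV | exact: wV].
split=> //; apply: (subgroup_index2 Gsub Hsub GN1).
  move=> /HP[_]; rewrite rhoN1 => /eqP.
  rewrite eq_sym -addr_eq0 -mulr2n -scaler_nat scaler_eq0 pnatr_eq0.
  by rewrite (negPf vCn).
move=> g gi nHg; rewrite invrN1 mulN1r.
(* Outside the subgroup the sign on [w] is [- 1], so [- g] fixes [w]. *)
have wg : w *m rho g = - w.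
  have [wg|//] := isom_eigen Cn0 vCn C_skew C_comm (isom_map_intr R gi).
  by case: nHg; apply/HP.
apply/HP; rewrite -mulN1r; split; first exact: GM.
by rewrite rhoM mulmxA rhoN1 mulNmx wg opprK.
Qed.
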